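(* Let $S$ be a group or an inverse semigroup with a finite choice of generators $X$ (as a semigroup, not necessarily symmetric). If $S$ has maximal global cogrowth with respect to $X$, then $S$ is amenable.
   Context: A finite choice of generators for a semigroup $S$ is a finite set $X$ of symbols together with a surjective morphism $X^+\to S$, $w\mapsto\overline{w}$, from the free semigroup on $X$; $|w|$ is the length of a word $w$. The global cogrowth function $\gamma^{S,X}(n)$ ($n\geq1$) is the number of pairs $(u,v)$ of non-empty words over $X$ with $|u|+|v|=n$ and $\overline{u}=\overline{v}$ in $S$. The global cogrowth rate is $\gamma^{S,X}=\limsup_{n\to\infty}(\gamma^{S,X}(n))^{1/n}\leq|X|$; $S$ has maximal global cogrowth (with respect to $X$) if $\gamma^{S,X}=|X|$. A semigroup $S$ is left amenable if there is a finitely additive probability measure $\mu$, defined on all subsets of $S$, such that $\mu(a^{-1}Y)=\mu(Y)$ for all $Y\subseteq S$ and $a\in S$, where $a^{-1}Y=\{s\in S: as\in Y\}$; right amenability is the left-right dual. For groups and inverse semigroups left and right amenability coincide, and such a semigroup is called amenable if it is left (equivalently right) amenable. An inverse semigroup is one in which every element $s$ has a unique $t$ with $sts=s$ and $tst=t$. *)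

(* Defs.v *)
From HB Require Import structures.
From mathcomp Require Import all_boot all_order all_algebra.
From mathcomp Require Import finmap.
From mathcomp Require Import all_classical all_reals all_analysis.

Set Implicit Arguments.
Unset Strict Implicit.
Unset Printing Implicit Defensive.

Import Order.TTheory GRing.Theory Num.Theory.

Local Open Scope classical_set_scope.

Record free_semigroup (X : Type) := NonemptyWord {
  letters :> seq X;
  letters_nonempty : ~~ nilp letters
}.

HB.instance Definition _ (X : Type) := [isSub for @letters X].
HB.instance Definition _ (X : choiceType) :=
  [Choice of free_semigroup X by <:].

Section FreeSemigroup.
Context {X : choiceType}.

Lemma catw_nonempty (u v : free_semigroup X) : ~~ nilp (letters u ++ letters v).
Proof. by case: u => -[]. Qed.

Definition catw (u v : free_semigroup X) : free_semigroup X :=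
  NonemptyWord (catw_nonempty u v).

Lemma catwA : associative catw.
Proof. by move=> u v w; apply: val_inj; rewrite /= catA. Qed.

HB.instance Definition _ := isSemigroup.Build (free_semigroup X) catwA.
End FreeSemigroup.

Section Cogrowth.
Context {X : finType} {S : semigroupType}.
Variable phi : {multiplicative free_semigroup X -> S}.

(* Words are non-empty by construction of [free_semigroup]. *)
Definition cogrowth_pairs (n : nat) : set (free_semigroup X * free_semigroup X) :=
  [set uv : free_semigroup X * free_semigroup X |
    (size uv.1 + size uv.2 = n)%N /\ phi uv.1 = phi uv.2].

Lemma finite_words (n : nat) :
  finite_set [set w : free_semigroup X | (size w <= n)%N].
Proof.
have fin_s : finite_set [set s : seq X | (size s <= n)%N]; last first.
  apply: (finite_preimage (f := @letters X)) fin_s.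
  by move=> u v _ _ uv; exact: val_inj.
apply: (@sub_finite_set _ _
  (\bigcup_(i in `I_n.+1) range (fun t : i.-tuple X => tval t))).
  by move=> s /= sn; exists (size s) => //; exists (in_tuple s).
by apply: bigcup_finite => // i _; exact: finite_image.
Qed.

(* Hence [fset_set] below does not take its default value. *)
Lemma finite_cogrowth_pairs (n : nat) : finite_set (cogrowth_pairs n).
Proof.
apply: sub_finite_set (finite_setX (finite_words n) (finite_words n)).
by move=> [u v] /= [<- _]; split => /=; [exact: leq_addr | exact: leq_addl].
Qed.

Definition global_cogrowth (n : nat) : nat :=
  #|` fset_set (cogrowth_pairs n) |%fset.

Definition global_cogrowth_rate (R : realType) : \bar R :=
  limn_esup (fun n : nat => (((global_cogrowth n)%:R `^ (n%:R^-1))%:E)%R).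

Definition maximal_global_cogrowth (R : realType) : Prop :=
  global_cogrowth_rate R = (#|X|%:R%:E)%R.

End Cogrowth.

Definition finitely_additive_probability (R : realType) (T : Type)
    (mu : set T -> R) : Prop :=
  [/\ forall A, (0 <= mu A)%R,
      mu [set: T] = 1%R
    & forall A B, A `&` B = set0 -> mu (A `|` B) = (mu A + mu B)%R].

Definition left_amenable (R : realType) (S : semigroupType) : Prop :=
  exists mu : set S -> R,
    finitely_additive_probability mu /\
    forall (a : S) (Y : set S), mu [set s | Y (a * s)%g] = mu Y.

(* For groups and inverse semigroups this agrees with right amenability: an
   invariant measure is carried to the other side along [s |-> s^-1]. *)
Definition amenable (R : realType) (S : semigroupType) : Prop :=
  left_amenable R S.

Definition inverse_semigroup (S : semigroupType) : Prop :=
  forall s : S, exists! t : S, (s * t * s = s)%g /\ (t * s * t = t)%g.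

(* Main.v *)
Require Import Defs.
From mathcomp Require Import all_boot all_order all_algebra.
From mathcomp Require Import generic_quotient finmap ring lra.
From mathcomp Require Import all_classical all_reals all_analysis.

Set Implicit Arguments.
Unset Strict Implicit.
Unset Printing Implicit Defensive.

Import Order.TTheory GRing.Theory Num.Theory numFieldNormedType.Exports.

Local Open Scope classical_set_scope.

(** A group is an inverse semigroup, so only inverse semigroups matter; these
are reduced to their largest group image [S / sigma], where [s] and [t] are
identified when [s * e = t * e] for some idempotent [e].  Left translations
of [S] induce injective maps of [S / sigma], and injectivity of the maps by
which the generators act is all that the analytic argument uses.

The analytic argument is a form of Kesten's criterion.  Let a letter [x] of
the finite alphabet [X], with [k] letters, act on a set [T] by an injective map
[L x], let [t0] be a point of [T], and let [N_p t] count the words of length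
[p] that send [t0] to [t].  The number of pairs of words of lengths [p] and
[q] with the same endpoint is the scalar product of [N_p] and [N_q], and
[N_(m + p)] is the sum, over the words [w] of length [m], of the translates
of [N_p] by [w], all of which have the norm of [N_p] by injectivity
([sphereD], [corr_act]).  If, for some [m], the squared norm of [N_(m + p)]
always fell short of its maximal value [k ^ (2 m) * |N_p|^2] by a fixed factor,
then [|N_p|^2] would be at most [C * (k tau) ^ (2 p)] for some [tau < 1], and
by Cauchy-Schwarz the number of coincident pairs of total length [n] would be
at most [(n + 1) * C * (k tau) ^ n], contradicting maximal cogrowth
([almost_maximal_growth], [maximal_cogrowth_not_submaximal]).

Hence for each [m] some [N_p] has translates by words of length [m] whose sum
is almost as long as possible, so the translates nearly coincide, and the
probability with density [N_p^2 / |N_p|^2] has almost the same image under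
any two words of the same length, at most [m] ([mass_close],
[sphere_mass_close]).  This alone does not give invariance, since words of
different lengths are not compared; averaging the images under
[1, x0, ..., x0 ^ (m - 1)] for a fixed letter [x0] repairs this, because a
further letter turns the word [x0 ^ j] into one of the length of
[x0 ^ (j + 1)] ([almost_invariant]).  A limit along an ultrafilter
is an invariant mean on [T] ([limit_invariant_mean]).

Finally the mean on [S / sigma] is lifted to [S] along an ultrafilter of
idempotents that go to zero in the natural order: for such [e], the products
[s * e] depend, in the limit, only on the class of [s]
([ultra_sigma], [lift_mean_invariant]). *)

(** * Multiplicity functions of finite lists *)

Section Multisets.
Context {R : realFieldType} {T : choiceType}.
Local Open Scope ring_scope.
Implicit Types (s : seq T) (Y : set T) (D : seq T).

Definition mult s t : R := (count_mem t s)%:R.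
Definition corr s s' : R := \sum_(t <- s) mult s' t.
(** The squared multiplicity function of [s], as a measure. *)
Definition mass s Y : R := \sum_(t <- s | t \in Y) mult s t.

(** Sums over [T] are taken over any duplicate-free list [D] that supports the
summand; [D] can be chosen common to several lists, which makes scalar products
bilinear in the multiplicity functions. *)
Lemma sum_mult D s (F : T -> R) : uniq D -> {subset s <= D} ->
  \sum_(t <- D) mult s t * F t = \sum_(t <- s) F t.
Proof.
move=> uD; elim: s => [|a s IH] sD.
  by rewrite big_nil big1 // => t _; rewrite /mult mul0r.
rewrite big_cons -IH; last by move=> t ts; apply: sD; rewrite inE ts orbT.
rewrite (eq_bigr (fun t => (a == t)%:R * F t + mult s t * F t)); last first.
  by move=> t _; rewrite /mult /= natrD mulrDl.
rewrite big_split /=; congr (_ + _).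
rewrite (bigD1_seq a) ?sD ?inE ?eqxx //= mul1r big1 ?addr0 // => t.
by rewrite eq_sym => /negPf ->; rewrite mul0r.
Qed.

Lemma corrE D s s' : uniq D -> {subset s <= D} ->
  corr s s' = \sum_(t <- D) mult s t * mult s' t.
Proof. by move=> uD sD; rewrite (sum_mult _ uD sD). Qed.

Lemma massE D s Y : uniq D -> {subset s <= D} ->
  mass s Y = \sum_(t <- D | t \in Y) mult s t ^+ 2.
Proof.
move=> uD sD; rewrite /mass big_mkcond /= -(sum_mult _ uD sD) [RHS]big_mkcond.
by apply: eq_bigr => t _; case: ifP; rewrite ?mulr0 ?expr2.
Qed.

Lemma mult_flatten W (I : seq W) (h : W -> seq T) t :
  mult (flatten (map h I)) t = \sum_(w <- I) mult (h w) t.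
Proof.
elim: I => [|w I IH]; first by rewrite big_nil.
by rewrite big_cons -IH /mult /= count_cat natrD.
Qed.

Lemma ler_sum_mem (W : eqType) (I : seq W) (F : W -> R) w :
  w \in I -> (forall v, 0 <= F v) -> F w <= \sum_(v <- I) F v.
Proof. by move=> wI F0; rewrite (big_rem w) //= lerDl sumr_ge0. Qed.

(** The parallelogram identity for finitely many vectors: it measures how far
they are from coinciding by how much their sum falls short of maximal
length. *)
Lemma sum_sqr_dist (W : eqType) (I : seq W) (h : W -> T -> R) D :
  \sum_(v <- I) \sum_(w <- I) \sum_(t <- D) (h v t - h w t) ^+ 2 =
  2 * (size I)%:R * (\sum_(w <- I) \sum_(t <- D) h w t ^+ 2)
  - 2 * \sum_(t <- D) (\sum_(w <- I) h w t) ^+ 2.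
Proof.
have -> : \sum_(v <- I) \sum_(w <- I) \sum_(t <- D) (h v t - h w t) ^+ 2 =
  \sum_(v <- I) \sum_(w <- I) (\sum_(t <- D) h v t ^+ 2 +
     \sum_(t <- D) h w t ^+ 2 - 2 * \sum_(t <- D) h v t * h w t).
  apply: eq_bigr => v _; apply: eq_bigr => w _.
  rewrite mulr_sumr -big_split -sumrB /=.
  by apply: eq_bigr => t _; ring.
rewrite (eq_bigr (fun v => (size I)%:R * (\sum_(t <- D) h v t ^+ 2) +
   (\sum_(w <- I) \sum_(t <- D) h w t ^+ 2) -
   2 * \sum_(t <- D) h v t * \sum_(w <- I) h w t)); last first.
  move=> v _; rewrite sumrB big_split /= big_const_seq count_predT iter_addr_0.
  rewrite -[X in X + _ - _]mulr_natl; congr (_ + _ - _).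
  rewrite -mulr_sumr exchange_big /=.
  by congr (_ * _); apply: eq_bigr => t _; rewrite mulr_sumr.
rewrite sumrB big_split /= big_const_seq count_predT iter_addr_0 -mulr_sumr.
rewrite -[X in _ + X - _]mulr_natl -mulr_sumr.
rewrite [X in _ - 2 * X]exchange_big /=.
rewrite [X in _ - 2 * X](eq_bigr (fun t => (\sum_(w <- I) h w t) ^+ 2)).
  by ring.
by move=> t _; rewrite -mulr_suml expr2.
Qed.

(** Close vectors have close squared densities: factor [f ^+ 2 - g ^+ 2] as
[(f - g) * (f + g)] and apply the weighted inequality between arithmetic and
geometric means, the weight [c] remaining free. *)
Lemma sqr_sum_close D Y (f g : T -> R) (c : R) : 0 < c ->
  `|\sum_(t <- D | t \in Y) f t ^+ 2 - \sum_(t <- D | t \in Y) g t ^+ 2| <=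
  (\sum_(t <- D) (f t - g t) ^+ 2) / (2 * c) +
  c * (\sum_(t <- D) f t ^+ 2 + \sum_(t <- D) g t ^+ 2).
Proof.
move=> c0; rewrite -sumrB mulrDr !mulr_sumr mulr_suml -!big_split /=.
apply: le_trans (ler_norm_sum _ _ _) _.
rewrite big_mkcond /=; apply: ler_sum => t _.
set x := f t; set y := g t.
have H : `|x ^+ 2 - y ^+ 2| <=
    (x - y) ^+ 2 / (2 * c) + (c * x ^+ 2 + c * y ^+ 2).
  (* The difference of the two sides is a complete square plus a nonnegative
     term, whichever the sign of [x ^+ 2 - y ^+ 2]. *)
  have e (z : R) : z = (x - y) * (x + y) \/ z = - ((x - y) * (x + y)) ->
      z <= (x - y) ^+ 2 / (2 * c) + (c * x ^+ 2 + c * y ^+ 2).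
    move=> hz; have c2 : 0 < 2 * c by rewrite mulr_gt0.
    rewrite -subr_ge0.
    have -> : (x - y) ^+ 2 / (2 * c) + (c * x ^+ 2 + c * y ^+ 2) - z =
        ((x - y) ^+ 2 + c ^+ 2 * (x + y) ^+ 2 - 2 * c * z
         + c ^+ 2 * (x - y) ^+ 2) / (2 * c).
      by field; rewrite gt_eqF.
    apply: divr_ge0; last exact: ltW.
    apply: addr_ge0; last by rewrite mulr_ge0 ?sqr_ge0.
    case: hz => ->.
      by have := sqr_ge0 (x - y - c * (x + y)); congr (_ <= _); ring.
    by have := sqr_ge0 (x - y + c * (x + y)); congr (_ <= _); ring.
  by rewrite ler_norml lerNl !e //; [left|right]; ring.
by case: ifP => // _; apply: le_trans H.
Qed.

Lemma sum_dist_corr (W : eqType) (I : seq W) (h : W -> seq T) (A : R) :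
  (forall w, corr (h w) (h w) = A) ->
  \sum_(v <- I) \sum_(w <- I) \sum_(t <- undup (flatten (map h I)))
     (mult (h v) t - mult (h w) t) ^+ 2 =
  2 * ((size I)%:R ^+ 2 * A - corr (flatten (map h I)) (flatten (map h I))).
Proof.
move=> hA; set D := undup _.
have uD : uniq D by exact: undup_uniq.
rewrite (sum_sqr_dist I (fun u => mult (h u)) D).
rewrite (eq_big_seq (fun=> A)) => [|u uI]; last first.
  rewrite -(hA u) (corrE _ uD) // => t tu.
  by rewrite mem_undup; apply/flattenP; exists (h u) => //; exact: map_f.
rewrite big_const_seq count_predT iter_addr_0 -[A *+ _]mulr_natl.
rewrite (@corrE D) //; last by move=> t; rewrite mem_undup.
rewrite (eq_bigr (fun t => mult (flatten (map h I)) t ^+ 2)).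
  by ring.
by move=> t _; rewrite mult_flatten.
Qed.

Lemma corr_flatten_le (W : eqType) (I : seq W) (h : W -> seq T) (A : R) :
  (forall w, corr (h w) (h w) = A) ->
  corr (flatten (map h I)) (flatten (map h I)) <= (size I)%:R ^+ 2 * A.
Proof.
move=> /(sum_dist_corr I) E; rewrite -subr_ge0 -(@pmulr_rge0 _ 2) // -E.
by do 3!(apply: sumr_ge0 => ? _); exact: sqr_ge0.
Qed.

(** If the sum of the vectors [h u] has almost maximal length, each single
distance in the parallelogram identity is small, and so any two of the
measures [mass (h u)] are close. *)
Lemma mass_close (W : eqType) (I : seq W) (h : W -> seq T) (A eps c : R) Y v w :
  0 < c -> (forall u, corr (h u) (h u) = A) ->
  (1 - eps) * (size I)%:R ^+ 2 * A <=
    corr (flatten (map h I)) (flatten (map h I)) ->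
  v \in I -> w \in I ->
  `|mass (h v) Y - mass (h w) Y| <= (eps * (size I)%:R ^+ 2 / c + 2 * c) * A.
Proof.
move=> c0 hA big vI wI.
pose D := undup (flatten (map h I)).
have uD : uniq D by exact: undup_uniq.
have sD u : u \in I -> {subset h u <= D}.
  move=> uI t tu; rewrite mem_undup; apply/flattenP; exists (h u) => //.
  exact: map_f.
rewrite (massE _ uD (sD _ vI)) (massE _ uD (sD _ wI)).
apply: le_trans (sqr_sum_close _ _ _ _ c0) _.
have nA u : u \in I -> \sum_(t <- D) mult (h u) t ^+ 2 = A.
  by move=> uI; rewrite -(hA u) (corrE _ uD (sD _ uI)).
rewrite !nA // [leRHS]mulrDl lerD //; last first.
  by rewrite -mulr2n -[A *+ 2]mulr_natl mulrCA mulrA.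
have le1 : \sum_(t <- D) (mult (h v) t - mult (h w) t) ^+ 2 <=
  2 * (eps * (size I)%:R ^+ 2 * A).
  have p0 v' w' : 0 <= \sum_(t <- D) (mult (h v') t - mult (h w') t) ^+ 2.
    by apply: sumr_ge0 => t _; exact: sqr_ge0.
  apply: (@le_trans _ _ (\sum_(w <- I) \sum_(t <- D)
      (mult (h v) t - mult (h w) t) ^+ 2)).
    exact: (ler_sum_mem (F := fun w => \sum_(t <- D)
      (mult (h v) t - mult (h w) t) ^+ 2)).
  apply: (@le_trans _ _ (\sum_(v <- I) \sum_(w <- I) \sum_(t <- D)
      (mult (h v) t - mult (h w) t) ^+ 2)).
    apply: (ler_sum_mem (F := fun v => \sum_(w <- I) \sum_(t <- D)
      (mult (h v) t - mult (h w) t) ^+ 2)) => // v'.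
    by apply: sumr_ge0.
  rewrite (sum_dist_corr I hA) ler_pM2l // lerBlDr -lerBlDl.
  by congr (_ <= _): big; ring.
rewrite ler_pdivrMr ?mulr_gt0 //.
apply: (le_trans le1); rewrite le_eqVlt; apply/orP; left; apply/eqP.
by field; rewrite gt_eqF.
Qed.

Lemma mult_ge0 s t : 0 <= mult s t. Proof. exact: ler0n. Qed.

Lemma corr_gt0 s : s != [::] -> 0 < corr s s.
Proof.
case: s => // a s _; rewrite /corr big_cons ltr_pwDl ?sumr_ge0 //.
by rewrite /mult /= eqxx ltr0n.
Qed.

Lemma mass_ge0 s Y : 0 <= mass s Y.
Proof. by apply: sumr_ge0 => t _; exact: mult_ge0. Qed.

Lemma mass_setT s : mass s setT = corr s s.
Proof. by apply: eq_bigl => t; rewrite in_setT. Qed.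

Lemma mass_setU s Y Z :
  Y `&` Z = set0 -> mass s (Y `|` Z) = mass s Y + mass s Z.
Proof.
move=> YZ; rewrite /mass [LHS]big_mkcond [in RHS]big_mkcond /=.
rewrite [X in _ + X]big_mkcond -big_split /=; apply: eq_bigr => t _.
rewrite in_setU; case: (boolP (t \in Y)) => tY /=; last by rewrite add0r.
suff /negPf -> : t \notin Z by rewrite addr0.
apply/negP => tZ; have : t \in Y `&` Z by rewrite in_setI tY.
by rewrite YZ in_set0.
Qed.

Lemma mult_map (g : T -> T) s t : injective g ->
  mult (map g s) (g t) = mult s t.
Proof.
move=> gI; rewrite /mult count_map; congr (_ %:R).
by apply: eq_count => x /=; rewrite (inj_eq gI).
Qed.

Lemma corr_map (g : T -> T) s s' : injective g ->
  corr (map g s) (map g s') = corr s s'.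
Proof.
by move=> gI; rewrite /corr big_map; under eq_bigr do rewrite mult_map//.
Qed.

Lemma mass_preimage (g : T -> T) s Y : injective g ->
  mass s (g @^-1` Y) = mass (map g s) Y.
Proof.
move=> gI; rewrite /mass big_map; under [RHS]eq_bigr do rewrite mult_map//.
by apply: eq_bigl => t; apply/idP/idP; rewrite !in_setE.
Qed.

(** Cauchy-Schwarz for norms bounded by geometric quantities [x] and [y]: after
rescaling the vectors by these, the inequality between arithmetic and geometric
means is sharp enough. *)
Lemma corr_le s s' (x y C : R) : 0 < x -> 0 < y ->
  corr s s <= C * x ^+ 2 -> corr s' s' <= C * y ^+ 2 ->
  corr s s' <= C * (x * y).
Proof.
move=> x0 y0 sC s'C.
pose D := undup (s ++ s').
have uD : uniq D by exact: undup_uniq.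
have sD : {subset s <= D} by move=> t ts; rewrite mem_undup mem_cat ts.
have sD' : {subset s' <= D} by move=> t ts; rewrite mem_undup mem_cat ts orbT.
have H : corr s s' <= (x * y) / 2 * (corr s s / x ^+ 2 + corr s' s' / y ^+ 2).
  rewrite !(corrE _ uD sD) (corrE _ uD sD') 2!mulr_suml -big_split mulr_sumr /=.
  apply: ler_sum => t _; set a := mult s t; set b := mult s' t.
  rewrite -subr_ge0.
  have -> : x * y / 2 * (a * a / x ^+ 2 + b * b / y ^+ 2) - a * b =
     (a * y - b * x) ^+ 2 / (2 * (x * y)).
    by field; rewrite !gt_eqF.
  by rewrite divr_ge0 ?sqr_ge0 // !mulr_ge0 // ltW.
apply: le_trans H _.
have -> : C * (x * y) = x * y / 2 * (C + C) by field.
rewrite ler_pM2l ?divr_gt0 ?mulr_gt0 //.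
by rewrite lerD // ler_pdivrMr ?exprn_gt0.
Qed.

End Multisets.

(** * Injective actions of an alphabet *)

Section Action.
Context {R : realType} {T : choiceType} {X : finType}.
Variables (L : X -> T -> T) (t0 : T).
Hypothesis L_inj : forall x, injective (L x).
Local Open Scope ring_scope.

Definition act (w : seq X) (t : T) : T := foldr L t w.

Fixpoint words m : seq (seq X) :=
  if m is m'.+1 then flatten [seq map (cons x) (words m') | x <- enum X]
  else [:: [::]].

(** Repetitions matter: the multiplicity of [t] in [sphere p] is the number of
words of length [p] that send [t0] to [t]. *)
Definition sphere p : seq T := [seq act w t0 | w <- words p].

Lemma act_inj w : injective (act w).
Proof. by elim: w => //= x w IH t u /L_inj /IH. Qed.

Lemma size_words m : size (words m) = (#|X| ^ m)%N.
Proof.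
elim: m => //= m IH; rewrite size_flatten /shape -map_comp.
rewrite (eq_map (g := fun=> (#|X| ^ m)%N)); last first.
  by move=> x /=; rewrite size_map.
by rewrite sumnE big_map big_enum /= sum_nat_const expnS.
Qed.

Lemma mem_words m w : (w \in words m) = (size w == m).
Proof.
elim: m w => [|m IH] [|x w] //=.
  by apply/negP => /flatten_mapP[x _ /mapP[]].
rewrite eqSS -IH; apply/flatten_mapP/idP => [[y _ /mapP[v vm [_ ->]]]//|wm].
by exists x; [rewrite mem_enum | exact: map_f].
Qed.

(** Seen as multiplicity functions: [N_(m + p)] is the sum of the translates of
[N_p] by the words of length [m]. *)
Lemma sphereD m p :
  sphere (m + p) = flatten [seq map (act w) (sphere p) | w <- words m].
Proof.
elim: m => [|m IH]; first by rewrite /= cats0 map_id.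
have -> : sphere (m.+1 + p) =
    flatten [seq map (L x) (sphere (m + p)) | x <- enum X].
  rewrite /sphere addSn /=; elim: (enum X) => //= x E IHE.
  by rewrite map_cat IHE -!map_comp.
rewrite IH /=; elim: (enum X) => //= x E ->.
rewrite map_cat flatten_cat; congr (_ ++ _).
rewrite map_flatten -!map_comp; congr flatten.
by apply: eq_map => w /=; rewrite -map_comp.
Qed.

Local Notation k := (#|X|%:R : R).
Let a p : R := corr (sphere p) (sphere p).

Lemma sphere_neq0 p : (0 < #|X|)%N -> sphere p != [::].
Proof.
by move=> X0; rewrite -size_eq0 size_map size_words -lt0n expn_gt0 X0.
Qed.

Lemma corr_act w p :
  corr (map (act w) (sphere p)) (map (act w) (sphere p)) = a p.
Proof. exact/corr_map/act_inj. Qed.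

Lemma corr_sphere_le m p : a (m + p)%N <= k ^+ (2 * m) * a p.
Proof.
rewrite /a sphereD; apply: le_trans (corr_flatten_le _ _) _.
  by move=> w; exact: corr_act.
by rewrite size_words natrX mulnC exprM.
Qed.

Lemma corr_sphere_gt0 p : (0 < #|X|)%N -> 0 < a p.
Proof. by move=> X0; apply/corr_gt0/sphere_neq0. Qed.

(** The first [m] terms are absorbed by the constant; steps of length [m] do the
rest. *)
Lemma geometric_decay (b : nat -> R) (Q : R) m : (0 < m)%N -> 0 < Q ->
  (forall p, 0 <= b p) ->
  (forall p, b (m + p)%N <= Q ^+ m * b p) ->
  exists C, forall p, b p <= C * Q ^+ p.
Proof.
move=> m0 Q0 b0 bm; exists (\sum_(r < m) b r / Q ^+ r) => p.
have [n] := ubnP p; elim: n p => // n IH p /ltnSE pn.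
have [pm|mp] := ltnP p m.
  rewrite -ler_pdivrMr ?exprn_gt0 // (bigD1 (Ordinal pm)) //= lerDl.
  by apply: sumr_ge0 => r _; rewrite divr_ge0 // exprn_ge0 // ltW.
rewrite -(subnKC mp) exprD mulrCA; apply: le_trans (bm _) _.
rewrite ler_pM2l ?exprn_gt0 //; apply: IH.
by rewrite (leq_trans _ pn) // ltn_subrL m0 (leq_trans m0 mp).
Qed.

Lemma bernoulli (x : R) n : x <= 1 -> 1 - n%:R * x <= (1 - x) ^+ n.
Proof.
move=> x1; elim: n => [|n IH]; first by rewrite mul0r subr0 expr0.
rewrite exprS -natr1; apply: (@le_trans _ _ ((1 - x) * (1 - n%:R * x))).
  rewrite -subr_ge0; have := mulr_ge0 (ler0n R n) (sqr_ge0 x).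
  by congr (_ <= _); ring.
by rewrite ler_wpM2l // subr_ge0.
Qed.

(** The number of coincidences grows at a rate below [k] in the total length of
the two words; this is what maximal cogrowth excludes. *)
Definition submaximal : Prop :=
  exists C tau : R, 0 < tau < 1 /\
  forall p q, corr (sphere p) (sphere q) <= C * (k * tau) ^+ (p + q).

(** Otherwise the squared norms decay, relative to [k ^+ (2 * p)], by a factor
[1 - eps] every [m] steps, and Cauchy-Schwarz carries the decay over to the
scalar products. *)
Lemma almost_maximal_growth m (eps : R) : (0 < #|X|)%N -> (0 < m)%N ->
  0 < eps < 1 -> ~ submaximal ->
  exists p, (1 - eps) * k ^+ (2 * m) * a p <= a (m + p)%N.
Proof.
move=> X0 m0 /andP[e0 e1]; apply: contra_notP => /forallNP H.
pose M : R := (2 * m)%:R; have M1 : 1 <= M by rewrite ler1n muln_gt0.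
have M0 : 0 < M by exact: lt_le_trans M1.
have eM : 0 < eps / M < 1.
  apply/andP; split; first exact: divr_gt0.
  by rewrite ltr_pdivrMr // mul1r (lt_le_trans e1).
(* Bernoulli's inequality gives [1 - eps <= tau ^+ (2 * m)]. *)
pose tau := 1 - eps / M.
have [t0' t1] : 0 < tau /\ tau < 1.
  by case/andP: eM => ? ?; rewrite subr_gt0 ltrBlDr ltrDl.
have kt : 0 < k * tau by rewrite mulr_gt0 // ltr0n.
have [C HC] : exists C, forall p, a p <= C * ((k * tau) ^+ 2) ^+ p.
  apply: (geometric_decay m0); first by rewrite exprn_gt0.
    by move=> p; rewrite ltW ?corr_sphere_gt0.
  move=> p; have /negP := H p; rewrite -ltNge => /ltW /le_trans; apply.
  rewrite ler_pM2r ?corr_sphere_gt0 // -exprM exprMn mulrC ler_pM2l; last first.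
    by rewrite exprn_gt0 // ltr0n.
  have := @bernoulli (eps / M) (2 * m).
  rewrite -/M -/tau mulrCA divff ?gt_eqF // mulr1.
  by apply; rewrite ltW //; case/andP: eM.
exists C, tau; split; first by rewrite t0' t1.
by move=> p q; rewrite exprD corr_le ?exprn_gt0 //
  -exprM mulnC exprM; exact: HC.
Qed.

(** One [p] serves all lengths up to [n]: each step multiplies the squared norm
by at most [k ^+ 2], so almost maximal growth over [n] steps forces almost
maximal growth over the first [j <= n] of them. *)
Lemma sphere_mass_close n (c : R) : (0 < #|X|)%N -> (0 < n)%N -> 0 < c < 1 ->
  ~ submaximal ->
  exists p, forall w w' Y, size w = size w' -> (size w <= n)%N ->
    `|mass (map (act w) (sphere p)) Y - mass (map (act w') (sphere p)) Y|
      <= c * a p.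
Proof.
move=> X0 n0 /andP[c0 c1] nsub.
have k1 : 1 <= k ^+ (2 * n) by rewrite exprn_ege1 // ler1n.
have kn0 : 0 < k ^+ (2 * n) by exact: lt_le_trans k1.
pose d := c / 3; have d0 : 0 < d by rewrite divr_gt0.
(* With weight [d], the bound of [mass_close] is at most [d + 2 * d = c]. *)
pose eps := d ^+ 2 / k ^+ (2 * n).
have e01 : 0 < eps < 1.
  apply/andP; split; first exact: divr_gt0 (exprn_gt0 _ d0) kn0.
  rewrite ltr_pdivrMr // mul1r (lt_le_trans _ k1) //.
  by rewrite exprn_ilt1 ?(ltW d0) // /d; lra.
have [p Hp] := almost_maximal_growth X0 n0 e01 nsub.
exists p => w w' Y ww' wn.
set j := size w in ww' wn.
have Hj : (1 - eps) * (size (words j))%:R ^+ 2 * a p <= a (j + p)%N.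
  rewrite size_words natrX -exprM [(j * 2)%N]mulnC.
  rewrite -(@ler_pM2l _ (k ^+ (2 * (n - j)))) ?exprn_gt0 ?ltr0n //.
  apply: le_trans (_ : a (n + p)%N <= _).
    apply: le_trans Hp; rewrite le_eqVlt; apply/orP; left; apply/eqP.
    by rewrite -[in RHS](subnK wn) mulnDr exprD; ring.
  by rewrite -{1}(subnK wn) -addnA; exact: corr_sphere_le.
rewrite /a sphereD in Hj.
apply: le_trans (mass_close (I := words j) _ d0 _ Hj _ _) _.
- by move=> u; exact: corr_act.
- by rewrite mem_words.
- by rewrite mem_words -ww'.
rewrite ler_pM2r ?corr_sphere_gt0 //.
apply: (@le_trans _ _ (d + 2 * d)); last by rewrite /d; lra.
rewrite lerD2r ler_pdivrMr // -expr2 /eps mulrAC ler_pdivrMr //.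
rewrite ler_pM2l ?exprn_gt0 // size_words natrX -exprM mulnC.
by rewrite ler_weXn2l ?ler1n // leq_mul2l.
Qed.

(** The measure of [sphere p] is averaged over its images under the powers
[x0 ^ j], [j <= n].  After a letter [y] acts, [y x0 ^ j] may be exchanged for
[x0 ^ j.+1], which has the same length, and the sum telescopes. *)
Lemma almost_invariant n : (0 < #|X|)%N -> ~ submaximal ->
  exists eta : set T -> R, finitely_additive_probability eta /\
    forall y Y, `|eta (L y @^-1` Y) - eta Y| <= 2 / n.+1%:R.
Proof.
move=> X0 nsub; have /card_gt0P[x0 _] := X0.
pose N : R := n.+1%:R; have N0 : 0 < N by rewrite ltr0n.
have c01 : 0 < (2 * N)^-1 < 1.
  have N2 : 1 < 2 * N by rewrite /N -natrM ltr1n mulnS.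
  by rewrite invr_gt0 (lt_trans ltr01 N2) invf_lt1 // (lt_trans ltr01 N2).
have [p Hp] := @sphere_mass_close n.+1 _ X0 (ltn0Sn n) c01 nsub.
have A0 := corr_sphere_gt0 p X0.
pose s j := map (act (nseq j x0)) (sphere p).
pose eta Y := (\sum_(j < n.+1) mass (s j) Y) / (N * a p).
have NA : 0 < N * a p by rewrite mulr_gt0.
exists eta; split.
  split=> [Y||Y Z YZ]; rewrite /eta.
  - by rewrite divr_ge0 ?(ltW NA) // sumr_ge0 // => j _; exact: mass_ge0.
  - under eq_bigr do rewrite mass_setT corr_act.
    by rewrite sumr_const card_ord -mulr_natl divff // gt_eqF.
  - by rewrite -mulrDl -big_split /=; under eq_bigr do rewrite mass_setU//.
move=> y Y; rewrite -mulrBl normrM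
  (gtr0_norm (_ : 0 < (N * a p)^-1)) ?invr_gt0 //.
rewrite ler_pdivrMr // mulrA divfK ?gt_eqF // -sumrB.
have -> : \sum_(j < n.+1) (mass (s j) (L y @^-1` Y) - mass (s j) Y) =
  \sum_(j < n.+1) (mass (s j) (L y @^-1` Y) - mass (s j.+1) Y) +
  (mass (s n.+1) Y - mass (s 0%N) Y) :> R.
  have E := @telescope_sumr R 0 n.+1 (fun j => mass (s j) Y) (leq0n _).
  rewrite -E.
  rewrite big_mkord -big_split /=.
  by apply: eq_bigr => j _; rewrite addrA subrK.
apply: le_trans (ler_normD _ _) _.
have le1 Z j : (0 : R) <= mass (s j) Z <= a p.
  rewrite mass_ge0 /= -(corr_act (nseq j x0)) -mass_setT -(setUv Z).
  by rewrite mass_setU ?setICr // lerDl mass_ge0.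
have -> : 2 * a p = a p + a p by rewrite mulrDl mul1r.
apply: lerD; last first.
  move: (le1 Y n.+1) (le1 Y 0%N) => /andP[? ?] /andP[? ?].
  by rewrite ler_norml; lra.
apply: le_trans (ler_norm_sum _ _ _) _.
apply: (@le_trans _ _ (\sum_(j < n.+1) ((2 * N)^-1 * a p))).
  apply: ler_sum => j _; rewrite mass_preimage // -map_comp.
  by apply: (Hp (y :: nseq j x0) (nseq j.+1 x0)); rewrite /= size_nseq.
rewrite sumr_const card_ord -[leLHS]mulr_natl -/N.
have -> : N * ((2 * N)^-1 * a p) = a p / 2 by field; rewrite gt_eqF.
by rewrite ler_pdivrMr // ler_peMr ?(ltW A0) // ler1n.
Qed.

End Action.

(** * Limits of almost invariant probabilities *)

Section Limit.
Context {R : realType}.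
Local Open Scope ring_scope.

(** By compactness the image of the ultrafilter has a cluster point, and an
ultrafilter converges to its cluster points. *)
Lemma bounded_ultra_cvg (I : Type) (U : set_system I) (u : I -> R) :
  UltraFilter U ->
  (forall i, 0 <= u i <= 1) -> exists l : R, u @ U --> l.
Proof.
move=> UU u01; have UF : ProperFilter U by exact: ultra_proper.
have U01 : (u @ U) [set` `[0, 1]].
  by apply: (@filterE _ U) => i /=; rewrite in_itv /=.
have [l [_ cl]] := @segment_compact R 0 1 (u @ U) _ U01.
exists l => V Vl; have [//|/= nV] := in_ultra_setVsetC (u @^-1` V) UU.
by have [x [nVx Vx]] := cl (~` V) V nV Vl.
Qed.

Lemma fap_le1 (T : Type) (mu : set T -> R) Y :
  finitely_additive_probability mu -> 0 <= mu Y <= 1.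
Proof.
move=> [mu0 mu1 muU]; rewrite mu0 /= -mu1 -(setUv Y).
by rewrite muU ?setICr // lerDl.
Qed.

Lemma limit_invariant_mean (T W : Type) (L : W -> T -> T) :
  (forall n, exists eta : set T -> R, finitely_additive_probability eta /\
    forall y Y, `|eta (L y @^-1` Y) - eta Y| <= 2 / n.+1%:R) ->
  exists mu : set T -> R, finitely_additive_probability mu /\
    forall y Y, mu (L y @^-1` Y) = mu Y.
Proof.
move=> /choice[eta Heta].
have [U [UU Uoo]] := ultraFilterLemma (eventually_filter).
have UF : ProperFilter U by exact: ultra_proper.
have fapE n := (Heta n).1.
have /choice[mu muP] : forall Y, exists l : R, eta n Y @[n --> U] --> l.
  by move=> Y; apply: bounded_ultra_cvg => n; exact: fap_le1.
exists mu; split; first split.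
- move=> Y; apply: (@cvgr_to_ge _ U _ _ (fun n => eta n Y)) (muP Y) _.
  by apply: filterE => n; case/andP: (fap_le1 Y (fapE n)).
- have := muP setT.
  have -> : (fun n => eta n setT) = (fun=> 1).
    by apply/funext => n; case: (fapE n).
  move=> h.
  by apply: (cvg_unique _ h (cvg_cst _)).
- move=> A B AB; have := muP (A `|` B).
  have -> : (fun n => eta n (A `|` B)) = (fun n => eta n A + eta n B).
    by apply/funext => n; case: (fapE n) => _ _ ->.
  by move=> h; apply: (cvg_unique _ h (cvgD (muP A) (muP B))).
move=> y Y; apply/eqP; rewrite -subr_eq0; apply/eqP.
have h : eta n (L y @^-1` Y) - eta n Y @[n --> U] --> mu (L y @^-1` Y) - mu Y.
  by apply: cvgB; exact: muP.
suff h0 : eta n (L y @^-1` Y) - eta n Y @[n --> U] --> (0 : R).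
  exact: (cvg_unique _ h h0).
apply/cvgrPdist_le => e e0.
apply: Uoo; near=> n; rewrite sub0r normrN.
apply: le_trans ((Heta n).2 y Y) _.
rewrite ler_pdivrMr // mulrC -ler_pdivrMr //.
apply: (@le_trans _ _ n%:R); last by rewrite ler_nat.
by near: n; exact: nbhs_infty_ger.
Unshelve. all: by end_near. Qed.
End Limit.

(** * Coincidences and the cogrowth rate *)

Section GrowthBound.
Context {R : realType}.
Local Open Scope ring_scope.

(** The linear factor counts the ways to split a total length [n].  Squaring
Bernoulli's inequality yields a quadratic lower bound for [(1 + e) ^+ (2 * n)],
which outgrows it. *)
Lemma absorb_linear_factor (C tau : R) : 0 < tau < 1 ->
  exists2 rho : R, 0 < rho < 1 & exists n0, forall n, (n0 <= n)%N ->
    n.+1%:R * (C * tau ^+ n) <= rho ^+ n.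
Proof.
move=> /andP[t0 t1]; pose e := (1 - tau) / 4.
have e0 : 0 < e by rewrite divr_gt0 // subr_gt0.
(* [e] is small enough for [tau * (1 + e) ^+ 2] to stay below 1. *)
exists (tau * (1 + e) ^+ 2).
  apply/andP; split; first by rewrite mulr_gt0 ?exprn_gt0 // addr_gt0.
  have te : tau = 1 - 4 * e by rewrite /e; field.
  have -> : tau * (1 + e) ^+ 2 = 1 - e * (2 + e * (7 + 4 * e)).
    by rewrite [in LHS]te; ring.
  by rewrite gtrBl mulr_gt0 // addr_gt0 // mulr_gt0 // addr_gt0 // mulr_gt0.
pose n0 := (Num.trunc (2 * `|C| / e ^+ 2)).+1.
exists n0 => n n0n.
have nC : 2 * `|C| <= n%:R * e ^+ 2.
  rewrite -ler_pdivrMr ?exprn_gt0 // ltW //.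
  by apply: lt_le_trans (truncnS_gt _) _; rewrite ler_nat.
rewrite exprMn mulrA mulrC ler_pM2l ?exprn_gt0 //.
have b : n%:R * e <= (1 + e) ^+ n.
  have := @bernoulli R (- e) n; rewrite opprK mulrN opprK => /(_ _) h.
  apply: le_trans (h _); first by rewrite lerDr.
  by rewrite lerNl (le_trans _ (ltW e0)) // lerN10.
have ne0 : 0 <= n%:R * e by rewrite mulr_ge0 // ltW.
rewrite -exprM mulnC exprM.
apply: (@le_trans _ _ ((n%:R * e) ^+ 2)); last first.
  by rewrite ler_pXn2r // nnegrE ?exprn_ge0 // addr_ge0 // ltW.
have n1 : (1 <= n%:R :> R) by rewrite ler1n (leq_trans _ n0n).
apply: (@le_trans _ _ (n%:R * (2 * `|C|))); last first.
  rewrite exprMn [n%:R ^+ 2]expr2 -mulrA ler_wpM2l //.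
rewrite mulrA -natr1; apply: le_trans (ler_norm _) _; rewrite normrM.
by rewrite ler_wpM2r // ger0_norm ?addr_ge0 // mulrDr mulr1 lerD2l.
Qed.

Lemma limn_esup_root_le (g : nat -> nat) (c : R) n0 : 0 < c ->
  (forall n, (n0 <= n)%N -> (g n)%:R <= c ^+ n) ->
  (limn_esup (fun n : nat => ((g n)%:R `^ (n%:R^-1))%:E) <= c%:E)%E.
Proof.
(* The tail starts after index 0, where the exponent [n%:R^-1] is 0. *)
move=> c0 H; apply: (@le_trans _ _ (ereal_sup
   ((fun n : nat => ((g n)%:R `^ (n%:R^-1))%:E) @` [set n | (n0.+1 <= n)%N]))).
  apply: ereal_inf_lbound; exists [set n | (n0.+1 <= n)%N] => //.
  exact: nbhs_infty_ge.
apply: ge_ereal_sup => _ [n /= nn <-]; rewrite lee_fin.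
have n1 : (n%:R : R) != 0 by rewrite pnatr_eq0 -lt0n (leq_trans _ nn).
have -> : c = (c ^+ n) `^ (n%:R^-1).
  by rewrite -powR_mulrn ?(ltW c0) // -powRrM mulfV // powRr1 // ltW.
rewrite ge0_ler_powR ?nnegrE ?invr_ge0 ?exprn_ge0 ?(ltW c0) //.
by apply: H; exact: ltnW.
Qed.

End GrowthBound.

Section CogrowthBound.
Context {R : realType} {S : semigroupType} {X : finType} {T : choiceType}.
Variables (phi : {multiplicative free_semigroup X -> S}) (q : S -> T).
Variables (L : X -> T -> T) (t0 : T).
Hypothesis qE : forall u : free_semigroup X, q (phi u) = act L (letters u) t0.
Local Open Scope ring_scope.

(** Words equal in [S] have the same endpoint, because by [qE] the endpoint
depends only on the element of [S]. *)
Lemma global_cogrowth_le n : ((global_cogrowth phi n)%:R : R) <=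
  \sum_(p < n.+1) corr (sphere L t0 p) (sphere L t0 (n - p)).
Proof.
pose pairs p := flatten [seq [seq (u, v) | v <- @words X (n - p) &
   act L v t0 == act L u t0] | u <- @words X p].
have size_pairs p : ((size (pairs p))%:R : R) =
    corr (sphere L t0 p) (sphere L t0 (n - p)).
  rewrite size_flatten /shape -map_comp sumnE big_map natr_sum /corr big_map.
  apply: eq_bigr => u _ /=; rewrite size_map size_filter /mult count_map.
  by congr (_%:R).
under eq_bigr do rewrite -size_pairs; rewrite -natr_sum ler_nat.
rewrite -(big_mkord xpredT (fun p => size (pairs p))).
have -> : (\sum_(0 <= p < n.+1) size (pairs p) =
    size (flatten [seq pairs p | p <- iota 0 n.+1]))%N.
  by rewrite size_flatten /shape -map_comp sumnE big_map /index_iota subn0.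
rewrite /global_cogrowth -(size_map (fun uv => (letters uv.1, letters uv.2))).
apply: uniq_leq_size.
  rewrite map_inj_uniq ?fset_uniq // => -[u v] [u' v'] /= [e1 e2].
  by congr (_, _); exact: val_inj.
move=> _ /mapP[[u v] uvF ->]; move: uvF.
rewrite in_fset_set; last exact: finite_cogrowth_pairs.
rewrite inE => -[]; set uv := (letters _, letters _) => sn e.
rewrite /= in sn e.
apply/flatten_mapP; exists (size u).
  by rewrite mem_iota /= ltnS -sn leq_addr.
apply/flatten_mapP; exists (letters u); first by rewrite mem_words.
apply/mapP; exists (letters v) => //.
by rewrite mem_filter mem_words -sn addKn eqxx andbT -!qE e.
Qed.

Lemma maximal_cogrowth_not_submaximal : (0 < #|X|)%N ->
  maximal_global_cogrowth phi R -> ~ submaximal (R := R) L t0.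
Proof.
move=> X0 maxi [C [tau [t01 H]]].
have [rho /andP[r0 r1] [n0 Hn]] := absorb_linear_factor C t01.
have k0 : 0 < #|X|%:R :> R by rewrite ltr0n.
have : (global_cogrowth_rate phi R <= (#|X|%:R * rho)%:E)%E.
  apply: (limn_esup_root_le (n0 := n0)); first exact: mulr_gt0.
  move=> n nn; apply: le_trans (global_cogrowth_le n) _.
  apply: (@le_trans _ _ (\sum_(p < n.+1) (C * (#|X|%:R * tau) ^+ n))).
    apply: ler_sum => p _; have := H p (n - p)%N.
    by rewrite subnKC // -ltnS.
  rewrite sumr_const card_ord -[leLHS]mulr_natl !exprMn.
  by rewrite [C * _]mulrCA [leLHS]mulrCA ler_pM2l ?exprn_gt0 // Hn.
by rewrite maxi lee_fin leNgt gtr_pMr // r1.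
Qed.

End CogrowthBound.

(** * Inverse semigroups and their group image *)

Section InverseSemigroup.
Context {S : semigroupType}.
Hypothesis invS : inverse_semigroup S.
Local Open Scope group_scope.
Local Open Scope quotient_scope.

Definition idem (e : S) : Prop := e * e = e.

Lemma inverse_exists (s : S) : exists t, s * t * s = s /\ t * s * t = t.
Proof. by have [t []] := invS s; exists t. Qed.

Lemma inverse_unique (s t u : S) : s * t * s = s -> t * s * t = t ->
  s * u * s = s -> u * s * u = u -> t = u.
Proof. by have [v [_ vU]] := invS s => *; rewrite -(vU t) // -(vU u). Qed.

(** If [x] is the inverse of [e * f] then so is [f * x * e]; uniqueness makes
[x] idempotent, hence its own inverse, hence equal to [e * f]. *)
Lemma idemM e f : idem e -> idem f -> idem (e * f).
Proof.
move=> ee ff; have [x [x1 x2]] := inverse_exists (e * f).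
have x2' : x * (e * (f * x)) = x by rewrite -[RHS]x2 !mulgA.
have xE : x = f * x * e.
  apply: (inverse_unique x1 x2).
    by rewrite !mulgA -(mulgA _ f f) ff -(mulgA _ e e) ee -[RHS]x1 !mulgA.
  rewrite !mulgA -(mulgA _ e e) ee -(mulgA _ f f) ff.
  by rewrite -[in RHS]x2' !mulgA.
have xx : x * x = x.
  have -> : x * x = f * (x * (e * (f * x))) * e by rewrite {1 2}xE !mulgA.
  by rewrite x2' -xE.
suff -> : e * f = x by [].
by apply: (@inverse_unique x); rewrite ?xx.
Qed.

(** Both products are inverses of the idempotent [e * f]. *)
Lemma idemC e f : idem e -> idem f -> e * f = f * e.
Proof.
move=> ee ff; have ef := idemM ee ff; have fe := idemM ff ee.
apply: (@inverse_unique (e * f)); rewrite ?ef //.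
  by rewrite !mulgA -(mulgA _ f f) ff -(mulgA _ e e) ee -[RHS]ef !mulgA.
by rewrite !mulgA -(mulgA _ e e) ee -(mulgA _ f f) ff -[RHS]fe !mulgA.
Qed.

(** The least congruence whose quotient is a group. *)
Definition sigma (s t : S) : bool :=
  `[< exists2 e, idem e & s * e = t * e >].

Lemma sigmaP s t : reflect (exists2 e, idem e & s * e = t * e) (sigma s t).
Proof. exact: asboolP. Qed.

Lemma exists_idem (s : S) : exists e, idem e.
Proof.
by have [t [st _]] := inverse_exists s; exists (s * t); rewrite /idem mulgA st.
Qed.

Lemma sigma_refl : reflexive sigma.
Proof. by move=> s; apply/sigmaP; have [e ee] := exists_idem s; exists e. Qed.

Lemma sigma_sym : symmetric sigma.
Proof. by move=> s t; apply/sigmaP/sigmaP => -[e ee E]; exists e. Qed.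

Lemma sigma_trans : transitive sigma.
Proof.
move=> t s u /sigmaP[e ee st] /sigmaP[f ff tu]; apply/sigmaP.
exists (e * f); first exact: idemM.
by rewrite mulgA st -mulgA (idemC ee ff) !mulgA tu.
Qed.

Definition sigma_equiv := EquivRel sigma sigma_refl sigma_sym sigma_trans.
Definition group_image := {eq_quot sigma_equiv}.

Lemma group_imageP (s t : S) :
  reflect (\pi_group_image s = \pi_group_image t) (sigma s t).
Proof. exact/eqquotP. Qed.

Lemma sigmaM a s t : sigma s t -> sigma (a * s) (a * t).
Proof.
by move=> /sigmaP[e ee st]; apply/sigmaP; exists e => //; rewrite -!mulgA st.
Qed.

Lemma sigma_mul_idem s e : idem e -> sigma (s * e) s.
Proof. by move=> ee; apply/sigmaP; exists e; rewrite // -mulgA ee. Qed.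

(** Conjugation by [s] moves an idempotent from one side to the other. *)
Lemma idem_mulC h s : idem h -> exists2 f, idem f & h * s = s * f.
Proof.
move=> hh; have [t [sts tst]] := inverse_exists s.
have st : idem (s * t) by rewrite /idem mulgA sts.
exists (t * h * s); last first.
  by rewrite !mulgA -(mulgA (s * t)) mulgA (idemC st hh) -!mulgA (mulgA s) sts.
rewrite /idem -!mulgA (mulgA s t) (mulgA h (s * t)) (idemC hh st).
by rewrite -!mulgA (mulgA h h) hh !mulgA tst.
Qed.

Lemma sigma_mul_idemr h s : idem h -> sigma (h * s) s.
Proof. by move=> /(idem_mulC s)[f ff ->]; exact: sigma_mul_idem. Qed.

(** With [b] the inverse of [a], multiplication by the idempotent [b * a] does
not change classes. *)
Lemma sigma_cancel a s t : sigma (a * s) (a * t) -> sigma s t.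
Proof.
have [b [aba bab]] := inverse_exists a.
have ba : idem (b * a) by rewrite /idem mulgA bab.
move=> /(sigmaM b); rewrite !mulgA => ST.
apply: (sigma_trans _ (sigma_mul_idemr t ba)).
by apply: sigma_trans ST; rewrite sigma_sym; exact: sigma_mul_idemr.
Qed.

(** The choice of representative is immaterial by [translate_pi]. *)
Definition translate (a : S) (t : group_image) : group_image :=
  \pi_group_image (a * repr t).

Lemma translate_pi a s : translate a (\pi s) = \pi_group_image (a * s).
Proof.
by apply/group_imageP/sigmaM/group_imageP; rewrite reprK.
Qed.

Lemma translate_inj a : injective (translate a).
Proof.
move=> t u /group_imageP/sigma_cancel/group_imageP.
by rewrite !reprK.
Qed.

(** The principal down-sets of the semilattice of idempotents form a filter
base, as [e * f] lies below both [e] and [f]. *)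
Lemma idem_ultrafilter (s : S) : exists U : set_system S, UltraFilter U /\
  forall e, idem e -> U [set f | e * f = f].
Proof.
pose F := filter_from [set e | idem e] (fun e => [set f | idem f /\ e * f = f]).
have FF : ProperFilter F.
  apply: filter_from_proper; last by move=> e ee; exists e.
  apply: filter_from_filter; first exact: exists_idem.
  move=> e f ee ff; exists (e * f); first exact: idemM.
  move=> g [gg efg]; split; split=> //.
    by rewrite -efg !mulgA ee.
  by rewrite -efg (idemC ee ff) !mulgA ff.
have [U [UU FU]] := ultraFilterLemma FF.
exists U; split=> // e ee; apply: FU; exists e => //.
by move=> f [].
Qed.

Section LiftMean.
Context {R : realType}.
Variables (U : set_system S) (M : set group_image -> R).
Hypothesis UU : UltraFilter U.
Hypothesis UE : forall e, idem e -> U [set f | e * f = f].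
Hypothesis M_fap : finitely_additive_probability M.
Let UF : ProperFilter U. Proof. exact: ultra_proper. Qed.

(** The classes whose elements, cut down by small idempotents, end up in [Y];
the choice of representative is immaterial by [ultra_sigma]. *)
Definition trace (Y : set S) : set group_image :=
  [set t | U [set e | Y (repr t * e)]].

Definition lift_mean (Y : set S) : R := M (trace Y).

(** If [s * e = t * e], then [s * f = t * f] for each [f] below [e]. *)
Lemma ultra_sigma s t (Y : set S) : sigma s t ->
  U [set e | Y (s * e)] -> U [set e | Y (t * e)].
Proof.
move=> /sigmaP[e ee st] UY.
apply: filterS (filterI UY (UE ee)) => f [/= Ysf ef].
by rewrite -ef mulgA -st -mulgA ef.
Qed.

Lemma lift_mean_fap : finitely_additive_probability lift_mean.
Proof.
case: M_fap => M0 M1 MU; split; rewrite /lift_mean.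
- by move=> Y; exact: M0.
- rewrite -M1; congr M; apply/seteqP; split=> // t _; exact: filterT.
move=> A B AB; rewrite -MU.
  congr M; apply/seteqP; split=> t /=.
    move=> UAB; have [|nA] := in_ultra_setVsetC [set e | A (repr t * e)] UU.
      by left.
    by right; apply: filterS (filterI UAB nA) => e /= [[]].
  by case; apply: filterS => e ?; [left|right].
apply/seteqP; split=> // t [UA UB]; apply: (@filter_not_empty _ U).
apply: filterS (filterI UA UB) => e /= [Ae Be].
by have : (A `&` B) (repr t * e) by []; rewrite AB.
Qed.

Lemma lift_mean_invariant a : (forall Z, M (translate a @^-1` Z) = M Z) ->
  forall Y, lift_mean [set s | Y (a * s)] = lift_mean Y.
Proof.
move=> Ma Y; rewrite /lift_mean -[RHS]Ma; congr M.
have aE t : sigma (repr (translate a t)) (a * repr t).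
  by apply/group_imageP; rewrite reprK.
apply/seteqP; split=> t /= Ut.
  apply: (@ultra_sigma (a * repr t)); first by rewrite sigma_sym.
  by apply: filterS Ut => e /=; rewrite mulgA.
by apply: filterS (ultra_sigma (aE t) Ut) => e /=; rewrite mulgA.
Qed.

End LiftMean.
End InverseSemigroup.

(** * Amenability from maximal cogrowth *)

Section Generators.
Context {S : semigroupType} {X : finType}.
Variable phi : {multiplicative free_semigroup X -> S}.
Local Open Scope group_scope.

Definition letter (x : X) : free_semigroup X := @NonemptyWord X [:: x] isT.

Lemma free_semigroup_ind (P : free_semigroup X -> Prop) :
  (forall x, P (letter x)) -> (forall x u, P u -> P (letter x * u)) ->
  forall u, P u.
Proof.
move=> P1 PS [w w0]; elim: w w0 => // x [|y w] IH w0.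
  by rewrite (_ : NonemptyWord _ = letter x) //; exact: val_inj.
rewrite (_ : NonemptyWord _ = letter x * @NonemptyWord X (y :: w) isT);
  last exact: val_inj.
by apply: PS; exact: IH.
Qed.

Lemma generators_invariant (R : realType) (mu : set S -> R) :
  set_surj [set: free_semigroup X] [set: S] phi ->
  (forall x Y, mu [set s | Y (phi (letter x) * s)] = mu Y) ->
  forall a Y, mu [set s | Y (a * s)] = mu Y.
Proof.
move=> sphi Hx a; have [u _ <-] := sphi a I.
elim/free_semigroup_ind: u => // x u IH Y.
rewrite -[RHS](Hx x) -[RHS]IH; congr mu; apply/seteqP; split=> s /=;
  by rewrite gmulfM mulgA.
Qed.

Lemma inverse_semigroup_amenable (R : realType) :
  [set: S] !=set0 -> inverse_semigroup S ->
  set_surj [set: free_semigroup X] [set: S] phi ->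
  maximal_global_cogrowth phi R -> amenable R S.
Proof.
move=> [s0 _] invS sphi maxi.
have X0 : (0 < #|X|)%N.
  have [[[|x w] //= _] _ _] := sphi s0 I.
  by apply/card_gt0P; exists x.
(* Any idempotent represents the identity of the group image. *)
have [e0 ee0] := exists_idem invS s0.
have [U [UU UE]] := idem_ultrafilter invS s0.
pose L x := translate (invS := invS) (phi (letter x)).
pose t0 := (\pi_(group_image invS) e0)%qT.
have qE (u : free_semigroup X) :
    (\pi_(group_image invS) (phi u))%qT = act L (letters u) t0.
  elim/free_semigroup_ind: u => [x|x u IH] /=.
    rewrite /L translate_pi; apply/esym/group_imageP.
    exact: sigma_mul_idem.
  by rewrite gmulfM -IH /L translate_pi.
have nsub := maximal_cogrowth_not_submaximal qE X0 maxi.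
have Linj x : injective (L x) by exact: translate_inj.
have [M [Mfap Minv]] := limit_invariant_mean
  (fun n => almost_invariant Linj n X0 nsub).
exists (lift_mean U M); split; first exact: lift_mean_fap.
apply: generators_invariant => // x.
exact/lift_mean_invariant/Minv.
Qed.

End Generators.

Lemma group_inverse_semigroup (S : groupType) : inverse_semigroup S.
Proof.
move=> s; exists (s^-1)%g; split; first by rewrite mulgV mul1g mulVg mul1g.
move=> t [sts _]; apply: (mulgI s); apply: (mulIg s).
by rewrite sts mulgV mul1g.
Qed.

Theorem corollary6p6 (R : realType) :
  (forall (S : groupType) (X : finType)
     (phi : {multiplicative free_semigroup X -> S}),
     set_surj [set: free_semigroup X] [set: S] phi ->
     maximal_global_cogrowth phi R -> amenable R S) /\
  (forall (S : semigroupType) (X : finType)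
     (phi : {multiplicative free_semigroup X -> S}),
     [set: S] !=set0 -> inverse_semigroup S ->
     set_surj [set: free_semigroup X] [set: S] phi ->
     maximal_global_cogrowth phi R -> amenable R S).
Proof.
split=> [S X phi|S X phi]; last exact: inverse_semigroup_amenable.
apply: inverse_semigroup_amenable; last exact: group_inverse_semigroup.
by exists 1%g.
Qed.
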